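(* Let $\mathbf x$ be a realisation of a homogeneous point process $X$ with constant intensity $\theta_0>0$, observed within $W\subseteq S$. Let $\{(\mathbf x_i^T,\mathbf x_i^V)\}_{i=1}^k$ be a Monte-Carlo or multinomial cross-validation partitioning of $\mathbf x$ and let $h:W\to\mathbb R$ be a test function satisfying $0<|\int_Wh(u)\,\mathrm du|<\infty$. Let the indicators be $I_i=\mathbf 1\{1\leq\#\mathbf x_i^T\}$, $i=1,\ldots,k$, so that $\mathcal T_k=\{i\in\{1,\ldots,k\}:\#\mathbf x_i^T\geq1\}$. Then the minimisers of $\theta\mapsto\widetilde{\mathcal I}_i(\theta)^2$, $i\in\mathcal T_k$, are given by $\widehat\theta_i^h$. Their sample median, $$\widehat\theta_1=\operatorname{med}\{\widehat\theta_i^h:i\in\mathcal T_k\}=\operatorname{med}\{(1-p)^{-1}\widetilde\theta_h(\mathbf x_i^T,W):i\in\mathcal T_k\},$$ coincides with the estimate obtained by minimising the loss function $\mathcal L_1$ with respect to $\theta\in\Theta=(0,\infty)$. Moreover, their sample mean, $$\widehat\theta_j=\frac1{\#\mathcal T_k}\sum_{i\in\mathcal T_k}\widehat\theta_i^h=\frac1{(1-p)\#\mathcal T_k}\sum_{i\in\mathcal T_k}\widetilde\theta_h(\mathbf x_i^T,W),\qquad j=2,3,$$ coincides with the estimates obtained by minimising any of the loss functions $\mathcal L_j$, $j=2,3$, with respect to $\theta\in\Theta$. In addition, conditionally on $\mathbf x$ (expectation over the cross-validation randomness), $$\mathbb E[\widehat\theta_j]=\widetilde\theta_h(\mathbf x,W)=\frac{\sum_{x\in\mathbf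 x\cap W}h(x)}{\int_Wh(u)\,\mathrm du},\qquad j=2,3.$$ Here empty sums are $0$ and $0/0=0$, and in the case of multinomial cross-validation one sets $p=1/k$ throughout. If instead $I_i=1$, $i=1,\ldots,k$ (so that $\widehat\theta_i^h=0$ if $\mathbf x_i^T=\emptyset$), the results above remain the same but with $\mathcal T_k=\{1,\ldots,k\}$.
   Context: $S$ is a complete separable metric space with reference measure $|\cdot|$ (integration $\int\mathrm du$). A point process $X$ on $S$ is homogeneous with intensity $\theta_0$ if $\mathbb E[\#(X\cap A)]=\theta_0|A|$ for all Borel $A\subseteq S$. $\mathbf x\subseteq W$ is a finite point pattern. Cross-validation: (Monte-Carlo CV) given $p\in(0,1)$ and $k\geq1$, the validation sets $\mathbf x_1^V,\ldots,\mathbf x_k^V$ are independently generated $p$-thinnings of $\mathbf x$ (each point of $\mathbf x$ is retained in $\mathbf x_i^V$ independently with probability $p$) and the training sets are $\mathbf x_i^T=\mathbf x\setminus\mathbf x_i^V$. (Multinomial CV) given $k\geq2$, the points $x\in\mathbf x$ get iid marks $m(x)$ uniform on $\{1,\ldots,k\}$, $\mathbf x_i^V=\{x\in\mathbf x:m(x)=i\}$ and $\mathbf x_i^T=\mathbf x\setminus\mathbf x_i^V$; here $p=1/k$. For $\theta\in\Theta=(0,\infty)$ put $$\mathcal I_i(\theta)=\sum_{x\in\mathbf x_i^T\cap W}h(x)-\theta(1-p)\int_Wh(u)\,\mathrm du,\qquad\widetilde{\mathcal I}_i(\theta)=I_i\,\mathcal I_i(\theta),\qquad i=1,\ldots,k,$$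 where $I_i\in\{0,1\}$ are indicators and $\mathcal T_k=\{i\in\{1,\ldots,k\}:I_i=1\}$. The loss functions are $$\mathcal L_1(\theta)=\frac1k\sum_{i=1}^k|\widetilde{\mathcal I}_i(\theta)|,\quad\mathcal L_2(\theta)=\frac1k\sum_{i=1}^k\widetilde{\mathcal I}_i(\theta)^2,\quad\mathcal L_3(\theta)=\Big(\frac1k\sum_{i=1}^k\widetilde{\mathcal I}_i(\theta)\Big)^2.$$ For a point pattern $\mathbf y$, the $h$-weighted intensity estimator is $\widetilde\theta_h(\mathbf y,W)=\sum_{x\in\mathbf y\cap W}h(x)\big/\int_Wh(u)\,\mathrm du$, and $$\widehat\theta_i^h=\frac{\sum_{x\in\mathbf x_i^T\cap W}h(x)}{(1-p)\int_Wh(u)\,\mathrm du}=\frac{\widetilde\theta_h(\mathbf x_i^T,W)}{1-p}.$$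
   Formalization: For I_i=1{#x_i^T≥1}, E[θ̂_j] is θ̃_h(x,W) times an explicit factor (printed identity fails for one point, h=1, k=2; it is kept for I_i=1 and fixed index sets). As h is signed, estimates minimise over ℝ, and over Θ if positive; L_1 uniqueness only for odd #T_k, L_2, L_3 for nonempty T_k. *)

(* Defs.v *)
From HB Require Import structures.
From mathcomp Require Import all_boot all_order all_algebra finmap.
From mathcomp Require Import all_classical all_reals all_analysis.
From mathcomp Require Import measurable_realfun.

Set Implicit Arguments.
Unset Strict Implicit.
Unset Printing Implicit Defensive.

Import Order.TTheory GRing.Theory Num.Theory.
Import numFieldNormedType.Exports.

Local Open Scope classical_set_scope.
Local Open Scope ring_scope.

#[short(type="completeMetricType")]
HB.structure Definition CompleteMetric (R : numDomainType) :=
  {T of Metric R T & Complete T}.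

Definition separable (T : topologicalType) : Prop :=
  exists2 D : set T, countable D & dense D.

Definition borel (S : ptopologicalType) := g_sigma_algebraType (@open S).

(* Simple and boundedly finite; a configuration is the set of its points. *)
Definition point_process (R : realType) (S : completeMetricType R)
    (d : measure_display) (T : measurableType d) (X : T -> set S) : Prop :=
  (forall w (c : S) (r : R), finite_set (X w `&` ball c r)) /\
  (forall A : set (borel S), measurable A ->
     measurable_fun setT (fun w => counting (X w `&` A) : \bar R)).

Definition homogeneous (R : realType) (S : completeMetricType R)
    (mu : {measure set (borel S) -> \bar R})
    (d : measure_display) (T : measurableType d) (P : probability T R)
    (X : T -> set S) (theta0 : R) : Prop :=
  forall A : set (borel S), measurable A ->
    (\int[P]_w counting (X w `&` A) = theta0%:E * mu A)%E.

(* For families with values in a discrete space, so that every set of values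
   is an event; measurability of the family is stated where this is used. *)
Definition mutually_independent (R : realType) (d : measure_display)
    (T : measurableType d) (P : probability T R) (J : finType) (V : Type)
    (Y : J -> T -> V) : Prop :=
  forall (K : {set J}) (A : J -> set V),
    P (\bigcap_(j in [set` K]) (Y j @^-1` A j)) =
    (\prod_(j in K) P (Y j @^-1` A j))%E.

Section cross_validation.
Context (R : realType) (S : choiceType).
Context (d : measure_display) (T : measurableType d) (P : probability T R).

Definition monte_carlo_cv (k : nat) (p : R) (x : {fset S})
    (V : 'I_k -> T -> {fset S}) : Prop :=
  [/\ forall i w, (V i w `<=` x)%fset,
      forall i u, u \in x -> measurable [set w | u \in V i w],
      forall i u, u \in x -> P [set w | u \in V i w] = p%:E
    & mutually_independent P
        (fun (iu : 'I_k * x) w => val iu.2 \in V iu.1 w)].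

Definition multinomial_cv (k : nat) (x : {fset S})
    (V : 'I_k -> T -> {fset S}) : Prop :=
  exists m : S -> T -> 'I_k,
  [/\ forall u i, u \in x -> measurable [set w | m u w = i],
      forall u i, u \in x -> P [set w | m u w = i] = (k%:R^-1)%:E,
      mutually_independent P (fun u : x => m (val u))
    & forall i w, V i w = [fset u in x | m u w == i]%fset].

Inductive cv_scheme := MonteCarlo | Multinomial.

Definition cv_partitioning (sch : cv_scheme) (k : nat) (p : R) (x : {fset S})
    (V : 'I_k -> T -> {fset S}) : Prop :=
  match sch with
  | MonteCarlo => [/\ (1 <= k)%N, 0 < p < 1 & monte_carlo_cv p x V]
  | Multinomial => [/\ (2 <= k)%N, p = k%:R^-1 & multinomial_cv x V]
  end.

End cross_validation.

Section estimators.
Context (R : realType) (S : completeMetricType R).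
Context (mu : {measure set (borel S) -> \bar R}) (W : set S) (h : S -> R).

Definition weighted_sum (y : {fset S}) : R := \sum_(u <- y | u \in W) h u.

Definition h_integral : R := \int[mu]_(u in (W : set (borel S))) h u.

Definition theta_tilde (y : {fset S}) : R := weighted_sum y / h_integral.

Definition innovation (p : R) (y : {fset S}) (theta : R) : R :=
  weighted_sum y - theta * (1 - p) * h_integral.

Definition theta_hat (p : R) (y : {fset S}) : R :=
  weighted_sum y / ((1 - p) * h_integral).

End estimators.

Section losses.
Context (R : realType) (k : nat) (Itilde : 'I_k -> R -> R).

Definition loss1 (theta : R) : R := k%:R^-1 * \sum_(i < k) `|Itilde i theta|.

Definition loss2 (theta : R) : R := k%:R^-1 * \sum_(i < k) Itilde i theta ^+ 2.

Definition loss3 (theta : R) : R := (k%:R^-1 * \sum_(i < k) Itilde i theta) ^+ 2.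

End losses.

(* The middle order statistic, or the mean of the two middle ones; 0 on the
   empty sample. *)
Definition sample_median (R : realType) (s : seq R) : R :=
  let t := sort <=%R s in
  (t`_(size s).-1./2 + t`_(size s)./2) / 2.

(* 0 on the empty sample, since 0^-1 = 0. *)
Definition sample_mean (R : realType) (J : finType) (K : {set J})
    (f : J -> R) : R :=
  (#|K|%:R)^-1 * \sum_(i in K) f i.

Definition argmin (R : realType) (D : set R) (f : R -> R) : set R :=
  [set t | D t /\ forall s, D s -> f t <= f s].

Definition Theta (R : realType) : set R := [set t | 0 < t].

(* As h is signed, t need not lie in the parameter space (0, +oo). It is the
   only minimiser of the formula f over the real line; over (0, +oo) it is the
   only minimiser if t > 0, and there is no minimiser otherwise. *)
Definition uniquely_minimised_at (R : realType) (f : R -> R) (t : R) : Prop :=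
  argmin setT f = [set t] /\ argmin (@Theta R) f = @Theta R `&` [set t].

(* Same convention, without uniqueness. *)
Definition minimised_at (R : realType) (f : R -> R) (t : R) : Prop :=
  argmin setT f t /\ (Theta t -> argmin (@Theta R) f t).

(* If folds with an empty training set are discarded, then conditionally on a
   pattern of n points the mean of the sample mean of the estimates is
   theta_tilde times this factor.
   - Thinning: a point lies in a given training set with probability
     (1 - p) / (1 - p^n) given that this set is nonempty, and at least one
     training set is nonempty with probability 1 - p^(n k).
   - Marks: with probability k^(1 - n) all points get the same mark; one fold
     is then discarded and the training sets of the others are the whole
     pattern, so that each estimate is k / (k - 1) times theta_tilde. Otherwise
     no fold is discarded and the sample mean is theta_tilde. *)
Definition discard_factor (R : realType) (sch : cv_scheme) (k n : nat) (p : R)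
    : R :=
  match sch with
  | MonteCarlo => (1 - p ^+ (n * k)) / (1 - p ^+ n)
  | Multinomial => 1 + (k%:R ^+ n.-1 * (k%:R - 1))^-1
  end.

(* Main.v *)
Require Import Defs.
From HB Require Import structures.
From mathcomp Require Import all_boot all_order all_algebra finmap.
From mathcomp Require Import all_classical all_reals all_analysis.
From mathcomp Require Import measurable_realfun zify ring lra.

Set Implicit Arguments.
Unset Strict Implicit.
Unset Printing Implicit Defensive.

Import Order.TTheory GRing.Theory Num.Theory.
Import numFieldNormedType.Exports.

Local Open Scope classical_set_scope.
Local Open Scope ring_scope.

(* Put c = (1 - p) int_W h. The i-th term is I_i c (theta_i - theta), so that
   L_1 is a multiple of the sum of the absolute deviations from the retained
   theta_i, hence minimal at their median, while L_2 and L_3 are quadratic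
   polynomials in theta with vertex at their mean.

   For the expectations, each theta_i is a linear combination of the indicators
   of "u lies in the i-th training set", u in x, and these are functions of a
   random element of a finite set whose law is a product. When empty training
   sets are discarded, the mean over the retained folds is evaluated by
   conditioning: on the set of retained folds for thinning, and on whether all
   marks agree for multinomial cross-validation. *)

(** * Minimisers of quadratics and of sums of absolute deviations *)

Section minimisers.
Context (R : realType).
Implicit Types (f : R -> R) (t c e : R).

Lemma global_minimised_at f t : (forall s, f t <= f s) -> minimised_at f t.
Proof. by move=> ft; split=> [|t_gt0]; split. Qed.

(* If t <= 0 < s then f (s / 2) < f s by convexity, so that the infimum over
   the open half-line is not attained. *)
Lemma convex_uniquely_minimised_at f t :
  (forall l a b, 0 <= l <= 1 ->
     f (l * a + (1 - l) * b) <= l * f a + (1 - l) * f b) ->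
  (forall s, s != t -> f t < f s) -> uniquely_minimised_at f t.
Proof.
move=> fconv ft.
have fle s : f t <= f s by have [->//|/ft/ltW] := eqVneq s t.
split; apply/seteqP; split=> s /=.
- case=> _ /(_ t Logic.I) fst; apply/eqP/negPn/negP => /ft.
  by rewrite ltNge fst.
- by move=> ->; split.
- case=> s_gt0 fs; split=> //; apply/eqP/negPn/negP => /[dup] st /ft ts.
  have [t_gt0|t_le0] := ltP 0 t; first by move: ts; rewrite ltNge fs.
  have st_gt0 : 0 < s - t by move: s_gt0 t_le0; rewrite /Theta/=; lra.
  (* The weight for which the convex combination of [t] and [s] is [s / 2]; it is at most 1 because
     [t <= 0]. *)
  pose l := s / 2 / (s - t).
  have l_gt0 : 0 < l by rewrite !divr_gt0.
  have l_le1 : l <= 1.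
    by rewrite ler_pdivrMr// mul1r; move: s_gt0; rewrite /Theta/=; lra.
  have := fconv l t s; rewrite ltW//= l_le1 => /(_ isT).
  have -> : l * t + (1 - l) * s = s / 2 by rewrite /l; field; rewrite gt_eqF.
  have s2_gt0 : 0 < s / 2 by rewrite divr_gt0.
  by have := fs _ s2_gt0; nra.
- by case=> s_gt0 st; rewrite st in s_gt0 *; split.
Qed.

Lemma quadratic_uniquely_minimised_at f c e t :
  0 < c -> (forall s, f s = c * (s - t) ^+ 2 + e) -> uniquely_minimised_at f t.
Proof.
move=> c_gt0 fE; apply: convex_uniquely_minimised_at => [l a b /andP[l0 l1]|s st].
  have -> : l * f a + (1 - l) * f b
      = f (l * a + (1 - l) * b) + c * (l * (1 - l) * (a - b) ^+ 2).
    by rewrite !fE; ring.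
  rewrite lerDl mulr_ge0 ?(ltW c_gt0)// mulr_ge0 ?sqr_ge0//.
  by rewrite mulr_ge0 ?subr_ge0.
rewrite !fE subrr expr0n/= mulr0 add0r ltrDr mulr_gt0//.
by rewrite exprn_even_gt0//= subr_eq0.
Qed.

(** Allowing [c = 0] covers the case without retained folds, where the loss is constant and
    uniqueness fails. *)
Lemma quadratic_minimised_at f c e t :
  0 <= c -> (forall s, f s = c * (s - t) ^+ 2 + e) -> minimised_at f t.
Proof.
move=> c_ge0 fE; apply: global_minimised_at => s; rewrite !fE.
by rewrite subrr expr0n/= mulr0 add0r lerDr mulr_ge0// sqr_ge0.
Qed.

Lemma sum_deviations_convex (s : seq R) l a b : 0 <= l <= 1 ->
  \sum_(y <- s) `|y - (l * a + (1 - l) * b)| <=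
    l * (\sum_(y <- s) `|y - a|) + (1 - l) * \sum_(y <- s) `|y - b|.
Proof.
move=> /andP[l0 l1]; rewrite !mulr_sumr -big_split/=; apply: ler_sum => y _.
have -> : y - (l * a + (1 - l) * b) = l * (y - a) + (1 - l) * (y - b) by ring.
rewrite (le_trans (ler_normD _ _))// !normrM (ger0_norm l0).
  by rewrite (@ger0_norm _ (1 - l)) ?subr_ge0.
Qed.

(** Adding the sum to its reversal pairs each index with its mirror image. Doubling avoids splitting
    on the parity of the size: a middle index is simply its own mirror. *)
Lemma sum_deviations_pairs (s : seq R) t :
  (\sum_(y <- s) `|y - t|) *+ 2 =
  \sum_(i < size s) (`|s`_i - t| + `|s`_(size s - i.+1) - t|).
Proof.
rewrite big_split/= (big_nth 0) big_mkord mulr2n; congr (_ + _).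
by rewrite [LHS](reindex_inj rev_ord_inj).
Qed.

(** Both central indices [(size s).-1./2] and [(size s)./2] lie between [i] and its mirror
    [size s - i.+1], and the median averages the values there. *)
Lemma sample_median_between (s : seq R) i : (i <= (size s).-1./2)%N ->
  (i < size s)%N ->
  (sort <=%R s)`_i <= sample_median s <= (sort <=%R s)`_(size s - i.+1).
Proof.
move=> im isz; rewrite /sample_median; set u := sort <=%R s.
have umono a b : (a <= b < size s)%N -> u`_a <= u`_b.
  move=> /andP[ab bs]; apply: le_sorted_leq_nth => //.
  + exact: Order.TotalTheory.sort_le_sorted.
  + by rewrite inE size_sort (leq_ltn_trans ab).
  + by rewrite inE size_sort.
have h1 : u`_i <= u`_(size s).-1./2 by apply: umono; lia.
have h2 : u`_(size s).-1./2 <= u`_(size s)./2 by apply: umono; lia.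
have h3 : u`_(size s)./2 <= u`_(size s - i.+1) by apply: umono; lia.
by apply/andP; split; lra.
Qed.

Lemma sum_sort_deviations (s : seq R) t :
  \sum_(y <- s) `|y - t| = \sum_(y <- sort <=%R s) `|y - t|.
Proof. by apply: perm_big; rewrite perm_sym; apply/permPl/perm_sort. Qed.

(* Pairing the i-th smallest and the i-th largest value, each pair contributes
   at least their distance, which the median attains by lying between them. *)
Lemma deviation_pair (s : seq R) t (i : 'I_(size s)) :
  `|(sort <=%R s)`_i - sample_median s| +
    `|(sort <=%R s)`_(size s - i.+1) - sample_median s| <=
  `|(sort <=%R s)`_i - t| + `|(sort <=%R s)`_(size s - i.+1) - t|.
Proof.
set u := sort <=%R s; set m := sample_median s.
have [im|im] := leqP i (size s).-1./2.
  have /andP[a b] := sample_median_between im (ltn_ord i).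
  rewrite ler0_norm ?subr_le0// ger0_norm ?subr_ge0//.
  by do 2 case: ler0P => ?; rewrite -/u -/m in a b *; lra.
(* Past the middle, the mirror index is in the lower half, and the same bounds hold with the two
   terms exchanged. *)
have jm : (size s - i.+1 <= (size s).-1./2)%N by lia.
have js : (size s - i.+1 < size s)%N by have := ltn_ord i; lia.
have := sample_median_between jm js.
rewrite (_ : (size s - (size s - i.+1).+1)%N = i) => [/andP[a b]|]; last first.
  by have := ltn_ord i; lia.
rewrite ger0_norm ?subr_ge0// ler0_norm ?subr_le0//.
by do 2 case: ler0P => ?; rewrite -/u -/m in a b *; lra.
Qed.

Lemma sample_median_min (s : seq R) t :
  \sum_(y <- s) `|y - sample_median s| <= \sum_(y <- s) `|y - t|.
Proof.
suff : (\sum_(y <- s) `|y - sample_median s|) *+ 2 <=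
    (\sum_(y <- s) `|y - t|) *+ 2 by rewrite lerMn2r.
rewrite (sum_sort_deviations s t) sum_sort_deviations !sum_deviations_pairs.
by rewrite size_sort; apply: ler_sum => i _; apply: deviation_pair.
Qed.

(** For odd size the middle index is paired with itself. Its pair contributes 0 at the median and a
    positive amount at any other point, which makes the pairwise comparison strict. *)
Lemma sample_median_odd_min (s : seq R) t : odd (size s) ->
  t != sample_median s ->
  \sum_(y <- s) `|y - sample_median s| < \sum_(y <- s) `|y - t|.
Proof.
move=> sodd tm; suff : (\sum_(y <- s) `|y - sample_median s|) *+ 2 <
    (\sum_(y <- s) `|y - t|) *+ 2 by rewrite ltrMn2r.
rewrite (sum_sort_deviations s t) sum_sort_deviations.
rewrite !sum_deviations_pairs size_sort.
have ms : ((size s)./2 < size s)%N by lia.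
rewrite (bigD1 (Ordinal ms))//= [ltRHS](bigD1 (Ordinal ms))//=.
apply: ltr_leD; last by apply: ler_sum => i _; apply: deviation_pair.
have -> : (size s - (size s)./2.+1 = (size s)./2)%N by lia.
have mE : sample_median s = (sort <=%R s)`_(size s)./2.
  rewrite /sample_median; have -> : ((size s).-1./2 = (size s)./2)%N by lia.
  by field.
by rewrite mE subrr normr0 addr0 addr_gt0// normr_gt0 subr_eq0 eq_sym -mE.
Qed.

End minimisers.

(** * Sums over finite functions against product weights *)

Section product_weights.
Context (R : comNzRingType) (J A : finType) (q : A -> R).
Hypothesis q1 : \sum_a q a = 1.

Lemma sum_prod_weight : \sum_(f : {ffun J -> A}) \prod_j q (f j) = 1.
Proof.
rewrite -(bigA_distr_bigA (fun _ : J => q)) big1// => j _; exact: q1.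
Qed.

Lemma sum_prod_weight_marginal (j0 : J) (g : A -> R) :
  \sum_(f : {ffun J -> A}) (\prod_j q (f j)) * g (f j0) = \sum_a q a * g a.
Proof.
(* Absorbing [g] into the factor at [j0] turns the summand back into a product, so the sum
   distributes; the other coordinates sum to 1. *)
pose F j a := q a * (if j == j0 then g a else 1).
rewrite (eq_bigr (fun f : {ffun J -> A} => \prod_j F j (f j))) => [|f _].
  rewrite -(bigA_distr_bigA F) (bigD1 j0)//= [X in _ * X]big1 ?mulr1 => [|j jj0].
    by apply: eq_bigr => a _; rewrite /F eqxx.
  by rewrite -q1; apply: eq_bigr => a _; rewrite /F (negbTE jj0) mulr1.
rewrite /F big_split/=; congr (_ * _).
by rewrite (bigD1 j0)//= eqxx big1 ?mulr1// => j /negbTE ->.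
Qed.

(** Fixing the set of indices where [b] holds constrains each coordinate separately, so the sum
    still factorises. *)
Lemma sum_prod_weight_family (b : pred A) (K : {set J}) (G : J -> A -> R) :
  \sum_(f : {ffun J -> A} | [set j | b (f j)]%SET == K) \prod_j G j (f j) =
  \prod_j \sum_(a | b a == (j \in K)) G j a.
Proof.
rewrite (bigA_distr_big_dep (fun j a => b a == (j \in K)) G).
apply: eq_bigl => f; apply/eqP/familyP => [<- j|bK].
  by rewrite inE unfold_in.
by apply/finset.setP => j; rewrite inE; exact/eqP/bK.
Qed.

End product_weights.

(** * Averages over a random set of retained indices *)

Section discarded_mean.
Context (R : numFieldType) (J A : finType) (q g : A -> R) (b : pred A).
Hypothesis q1 : \sum_a q a = 1.

(* Conditionally on the set K <> set0 of indices at which b holds, the average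
   of g over K has the mean of g under q conditioned on b. The denominator of
   this conditional mean is moved to the left-hand side. *)
Lemma sum_prod_weight_mean :
  (\sum_(a | b a) q a) * \sum_(f : {ffun J -> A}) (\prod_j q (f j)) *
    (#|[set j | b (f j)]%SET|%:R^-1 * \sum_(j | b (f j)) g (f j)) =
  (\sum_(a | b a) q a * g a) * (1 - (1 - \sum_(a | b a) q a) ^+ #|J|).
Proof.
pose bset (f : {ffun J -> A}) := [set j | b (f j)]%SET.
set beta := \sum_(a | b a) q a; set alpha := \sum_(a | b a) q a * g a.
have weightC : \sum_(f : {ffun J -> A} | [set j | b (f j)]%SET == finset.set0)
    \prod_j q (f j) = (1 - beta) ^+ #|J|.
  rewrite (sum_prod_weight_family _ _ (fun _ => q)) -[RHS]prodr_const.
  apply: eq_bigr => j _; rewrite finset.inE -q1 [in RHS](bigID b)/=.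
  rewrite -/beta [RHS]addrC addKr.
  by apply: eq_bigl => a; rewrite eqbF_neg.
have weightK : \sum_(f : {ffun J -> A} | [set j | b (f j)]%SET != finset.set0)
    \prod_j q (f j) = 1 - (1 - beta) ^+ #|J|.
  apply/eqP; rewrite eq_sym subr_eq -weightC -[X in X == _](sum_prod_weight J q1).
  by rewrite (bigID (fun f : {ffun J -> A} => bset f == finset.set0)) addrC.
rewrite -weightK.
rewrite (partition_big bset xpredT)//=.
rewrite [in RHS](partition_big bset (fun K => K != finset.set0))//=.
(* The empty set contributes 0 to the left-hand side because the inverse of its cardinality is 0. *)
rewrite [in LHS](bigID (fun K => K != finset.set0))/= [X in _ + X]big1 ?addr0;
  last first=> [K|].
  rewrite negbK => /eqP ->; apply: big1 => f /eqP fK.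
  by rewrite -/(bset f) fK cards0 invr0 mul0r mulr0.
rewrite !mulr_sumr; apply: eq_bigr => K K0.
have KE (f : {ffun J -> A}) : bset f == K -> forall j, b (f j) = (j \in K).
  by move=> /eqP <- j; rewrite inE.
have cK : #|K|%:R != 0 :> R by rewrite pnatr_eq0 cards_eq0.
(* For fixed [K] both sides are written as averages over [K], to be compared one index at a time; on
   the right all terms are equal. *)
transitivity (\sum_(j in K) #|K|%:R^-1 * (beta *
    \sum_(f : {ffun J -> A} | [set j | b (f j)]%SET == K)
       (\prod_j q (f j)) * g (f j))).
  rewrite -mulr_sumr -mulr_sumr exchange_big/= mulrCA; congr (_ * _).
  rewrite mulr_sumr; apply: eq_bigr => f fK.
  rewrite mulrCA -/(bset f) (eqP fK) -mulr_sumr; congr (_ * (_ * _)).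
  by apply: eq_bigl => j; rewrite KE.
transitivity (\sum_(j in K) #|K|%:R^-1 * (alpha *
    \sum_(f : {ffun J -> A} | [set j | b (f j)]%SET == K) \prod_j q (f j)));
  last first.
  rewrite sumr_const -[LHS]mulr_natl mulVKf//; congr (_ * _).
  by apply: eq_bigl => f; case: eqP => [->|]; rewrite ?andbF// K0.
apply: eq_bigr => i iK; congr (_ * _).
pose F j a := q a * (if j == i then g a else 1).
rewrite (eq_bigr (fun f : {ffun J -> A} => \prod_j F j (f j))) => [|f _];
  last first.
  rewrite /F big_split/=; congr (_ * _).
  by rewrite (bigD1 i)//= eqxx big1 ?mulr1// => j /negbTE ->.
(* The two factorisations differ only at coordinate [i], where they give [alpha] and [beta]
   respectively; the outer factors [beta] and [alpha] compensate. *)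
rewrite (sum_prod_weight_family _ _ F) (sum_prod_weight_family _ _ (fun _ => q)).
rewrite (bigD1 i)//= [in RHS](bigD1 i)//= iK.
rewrite (eq_bigl b) => [|a]; last by rewrite eqb_id.
rewrite [X in _ = _ * (X * _)](eq_bigl b) => [|a]; last by rewrite eqb_id.
rewrite (eq_bigr (fun a => q a * g a)) => [|a _]; last by rewrite /F eqxx.
rewrite mulrCA -/alpha -/beta; congr (_ * (_ * _)).
apply: eq_bigr => j /negbTE ji; apply: eq_bigr => a _.
by rewrite /F ji mulr1.
Qed.

End discarded_mean.

(** * Expectations of functions of a random element of a finite set *)

Section finite_law.
Context (R : realType) (d : measure_display) (T : measurableType d).
Context (P : probability T R).

Definition has_finite_law (A : finType) (Z : T -> A) (law : A -> R) : Prop :=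
  forall a, measurable (Z @^-1` [set a]) /\ P (Z @^-1` [set a]) = (law a)%:E.

(** [G (Z w)] is a finite linear combination of the indicators of the events [Z = a], integrated
    term by term. *)
Lemma expectation_finite_law (A : finType) (Z : T -> A) (law : A -> R)
    (G : A -> R) : has_finite_law Z law ->
  ('E_P[fun w => G (Z w)] = (\sum_a law a * G a)%:E)%E.
Proof.
move=> ZP; rewrite unlock.
have int1 a : P.-integrable setT (fun w => (\1_(Z @^-1` [set a]) w)%:E).
  by apply: integrable_indic; case: (ZP a).
transitivity (\int[P]_w \sum_a ((G a)%:E * (\1_(Z @^-1` [set a]) w)%:E))%E.
  apply: eq_integral => w _; rewrite (bigD1 (Z w))//= big1 ?adde0 => [|a aZ].
    by rewrite indicE mem_set// mule1.
  by rewrite indicE memNset ?mule0// => Za; rewrite -Za eqxx in aZ.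
rewrite integral_sum// => [|a]; last exact: integrableZl.
rewrite -sumEFin; apply: eq_bigr => a _; have [mZ PZ] := ZP a.
rewrite integralZl// integral_indic// setIT mulrC EFinM; congr (_ * _)%E.
exact: PZ.
Qed.

(** Each value of the joint vector is an intersection of coordinate events, to which independence
    applies with the full index set and singletons. *)
Lemma independent_finite_law (J A : finType) (Y : J -> T -> A) (q : A -> R) :
  mutually_independent P Y ->
  (forall j a, measurable [set w | Y j w = a]) ->
  (forall j a, P [set w | Y j w = a] = (q a)%:E) ->
  has_finite_law (fun w => [ffun j => Y j w]) (fun f => \prod_j q (f j)).
Proof.
move=> indY mY PY f.
have -> : (fun w => [ffun j => Y j w]) @^-1` [set f] =
    \bigcap_(j in [set` [set: J]%SET]) (Y j @^-1` [set f j]).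
  apply/seteqP; split=> w /=.
    by move=> /ffunP fE j _ /=; rewrite -fE ffunE.
  by move=> fE; apply/ffunP => j; rewrite ffunE; apply: fE; rewrite /= inE.
split.
  by apply: fin_bigcap_measurable => [|j _]; [exact: finite_finset|exact: mY].
rewrite indY -prodEFin; apply: eq_big => [j|j _]; first by rewrite inE.
exact: PY.
Qed.

End finite_law.

(** * Laws of the two cross-validation schemes *)

Section cross_validation_law.
Context (R : realType) (S : choiceType) (d : measure_display).
Context (T : measurableType d) (P : probability T R).
Context (k : nat) (p : R) (x : {fset S}) (V : 'I_k -> T -> {fset S}).

(** The value [true] stands for membership in the validation set, so training membership has weight
    [1 - p]. *)
Let q (b : bool) : R := if b then p else 1 - p.

Lemma bernoulli_weight : \sum_b q b = 1.
Proof. by rewrite big_bool/= /q addrC subrK. Qed.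

(** Independence is given over pairs of a fold and a point. The curried form makes the folds
    independent copies of one random subset, as needed to average over retained folds. *)
Lemma monte_carlo_law : monte_carlo_cv P p x V ->
  has_finite_law P (fun w => [ffun i => [ffun u : x => val u \in V i w]])
    (fun f : {ffun 'I_k -> {ffun x -> bool}} => \prod_i \prod_u q (f i u)).
Proof.
move=> [_ mV PV indV] f.
have [||] := @independent_finite_law _ _ _ P _ _ _ q indV _ _
    [ffun iu : 'I_k * x => f iu.1 iu.2].
- move=> [i u] b; case: b; first exact: mV (valP u).
  rewrite (_ : [set w | _] = ~` [set w | val u \in V i w]).
    by apply: measurableC; exact: mV (valP u).
  by apply/seteqP; split=> w /=; [move=> ->|move/negP/negbTE].
- move=> [i u] b; case: b; first exact: PV (valP u).
  rewrite (_ : [set w | _] = ~` [set w | val u \in V i w]).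
    rewrite probability_setC; last exact: mV (valP u).
    by rewrite PV ?(valP u)// -EFinB.
  by apply/seteqP; split=> w /=; [move=> ->|move/negP/negbTE].
have -> : (fun w => [ffun iu : 'I_k * x => val iu.2 \in V iu.1 w]) @^-1`
      [set [ffun iu => f iu.1 iu.2]] =
    (fun w => [ffun i => [ffun u : x => val u \in V i w]]) @^-1` [set f].
  apply/seteqP; split=> w /= /ffunP fE; apply/ffunP.
    by move=> i; apply/ffunP => u; have := fE (i, u); rewrite !ffunE.
  by case=> i u; rewrite !ffunE/= -fE !ffunE.
by move=> mf Pf; split=> //; rewrite Pf pair_bigA/=; congr EFin;
  apply: eq_bigr => iu _; rewrite ffunE.
Qed.

(** The folds are dependent, but all are read off one uniform map from points to marks. The law is
    kept as a product of constants so that the product-weight lemmas apply. *)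
Lemma multinomial_law : multinomial_cv P x V ->
  exists Z : T -> {ffun x -> 'I_k},
    has_finite_law P Z (fun f => \prod_(u : x) k%:R^-1) /\
    forall w i (u : x), (val u \in V i w) = (Z w u == i).
Proof.
move=> [m [mm Pm indm VE]]; exists (fun w => [ffun u => m (val u) w]); split.
  apply: (@independent_finite_law _ _ _ P _ _ _ (fun=> k%:R^-1) indm).
    by move=> u i; exact: mm (valP u).
  by move=> u i; exact: Pm (valP u).
by move=> w i u; rewrite VE !inE/= (valP u) ffunE.
Qed.

Lemma sum_monte_carlo_train (i : 'I_k) (u : x) :
  \sum_(f : {ffun 'I_k -> {ffun x -> bool}})
    (\prod_i \prod_u q (f i u)) * (~~ f i u)%:R = 1 - p.
Proof.
have Q1 := sum_prod_weight x bernoulli_weight.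
rewrite (sum_prod_weight_marginal Q1 i (fun r => (~~ r u)%:R)).
rewrite (sum_prod_weight_marginal bernoulli_weight u (fun b => (~~ b)%:R)).
by rewrite big_bool/= mulr0 add0r mulr1.
Qed.

(** This is [sum_prod_weight_mean] with folds as indices and [b] saying that the training set is
    nonempty. If [u] is in the training set then [b] holds, so the numerator stays [1 - p]; only the
    all-[true] map violates [b], with weight [p ^+ n] for a pattern of [n] points. *)
Lemma sum_monte_carlo_train_mean (u : x) : 0 < p < 1 ->
  \sum_(f : {ffun 'I_k -> {ffun x -> bool}})
    (\prod_i \prod_u q (f i u)) *
    (#|[set i | [exists u, ~~ f i u]]%SET|%:R^-1 *
      \sum_(i | [exists u, ~~ f i u]) (~~ f i u)%:R) =
  (1 - p) * discard_factor MonteCarlo k #|` x| p.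
Proof.
move=> /andP[p_gt0 p_lt1].
have Q1 := sum_prod_weight x bernoulli_weight.
have alphaE : \sum_(r : {ffun x -> bool} | [exists u, ~~ r u])
    (\prod_u q (r u)) * (~~ r u)%:R = 1 - p.
  transitivity (\sum_(r : {ffun x -> bool}) (\prod_u q (r u)) * (~~ r u)%:R).
    rewrite big_mkcond/=; apply: eq_bigr => r _.
    case: ifPn => // /existsPn/(_ u)/negbNE ->.
    by rewrite mulr0.
  rewrite (sum_prod_weight_marginal bernoulli_weight u (fun b => (~~ b)%:R)).
  by rewrite big_bool/= mulr0 add0r mulr1.
pose train (r : {ffun x -> bool}) := [exists u, ~~ r u].
have betaE : \sum_(r : {ffun x -> bool} | [exists u, ~~ r u])
    \prod_u q (r u) = 1 - p ^+ #|` x|.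
  rewrite -[X in _ = X - _]Q1 [in RHS](bigID train)/=.
  rewrite [X in _ + X - _](big_pred1 [ffun=> true]) => [|r].
    under [X in _ + X - _]eq_bigr do rewrite ffunE.
    by rewrite prodr_const -cardfE addrK.
  apply/existsPn/eqP => [rT|-> v]; last by rewrite /= ffunE.
  by apply/ffunP => v; rewrite ffunE; apply/negbNE/rT.
(* The point [u] makes the exponent positive, so the denominator of the discard factor is
   nonzero. *)
have pn_lt1 : p ^+ #|` x| < 1.
  rewrite exprn_ilt1 ?ltW// -lt0n cardfE; apply/card_gt0P; by exists u.
have := sum_prod_weight_mean 'I_k (fun r : {ffun x -> bool} => (~~ r u)%:R)
  (fun r : {ffun x -> bool} => [exists u, ~~ r u]) Q1.
rewrite alphaE betaE subKr -exprM card_ord => eqS.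
have pn_neq1 : 1 - p ^+ #|` x| != 0 by rewrite gt_eqF// subr_gt0.
by apply: (mulfI pn_neq1); rewrite eqS /=; field.
Qed.

Lemma uniform_weight : (1 < k)%N -> \sum_(j < k) k%:R^-1 = 1 :> R.
Proof.
move=> k_gt1; rewrite sumr_const card_ord -[LHS]mulr_natl divff// pnatr_eq0; lia.
Qed.

Lemma sum_multinomial_train (i : 'I_k) (u : x) : (1 < k)%N -> p = k%:R^-1 ->
  \sum_(f : {ffun x -> 'I_k}) (\prod_(u : x) k%:R^-1) * (f u != i)%:R = 1 - p.
Proof.
move=> k_gt1 pE; have q1 := uniform_weight k_gt1.
rewrite (sum_prod_weight_marginal q1 u (fun j => (j != i)%:R)).
rewrite pE -[X in _ = X - _]q1 (bigD1 i)//= eqxx mulr0 add0r [in RHS](bigD1 i)//=.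
rewrite [RHS]addrC addKr; apply: eq_bigr => j ji.
by rewrite ji mulr1.
Qed.

(** If all marks agree, the one discarded fold is the only one not training on [u], and the average
    is 1. Otherwise every fold is retained and [u] is in all training sets but one. The sum over [j]
    is the indicator that [f] is constant, since the value at [u] determines [j]. *)
Lemma mean_multinomial_train (f : {ffun x -> 'I_k}) (u : x) : (1 < k)%N ->
  #|[set i | [exists v, f v != i]]%SET|%:R^-1 *
    \sum_(i | [exists v, f v != i]) (f u != i)%:R =
  1 - k%:R^-1 + k%:R^-1 * \sum_j (f == [ffun=> j])%:R :> R.
Proof.
move=> k_gt1; have k_neq0 : k%:R != 0 :> R by rewrite pnatr_eq0; lia.
have kB1 : k.-1%:R = k%:R - 1 :> R by rewrite -subn1 natrB// ltnW.
have sum_neq : \sum_(i : 'I_k) (f u != i)%:R = k%:R - 1 :> R.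
  rewrite -kB1 (bigD1 (f u))//= eqxx add0r (eq_bigr (fun=> 1)) => [|i].
    by rewrite sumr_const cardC1 card_ord.
  by rewrite eq_sym => ->.
have [/eqP fE|fE] := boolP (f == [ffun=> f u]).
- have K (i : 'I_k) : [exists v, f v != i] = (i != f u).
    apply/existsP/idP => [[v]|ifu]; last by exists u; rewrite eq_sym.
    by rewrite fE !ffunE eq_sym.
  have -> : \sum_j (f == [ffun=> j])%:R = 1 :> R.
    rewrite (bigD1 (f u))//= -fE eqxx big1 ?addr0// => i ifu.
    by case: (f =P [ffun=> i]) => // fi; rewrite fi ffunE eqxx in ifu.
  have -> : [set i | [exists v, f v != i]]%SET = [set~ f u]%SET.
    by apply/finset.setP => i; rewrite !inE K.
  rewrite (eq_bigl _ _ K) (eq_bigr (fun=> 1)) => [|i]; last first.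
    by rewrite eq_sym => ->.
  rewrite sumr_const cardC1 cardsC1 card_ord kB1 mulVf ?mulr1 ?subrK//.
  by rewrite -kB1 pnatr_eq0; lia.
- have K (i : 'I_k) : [exists v, f v != i].
    apply: contraNT fE => /existsPn fi; apply/eqP/ffunP => v.
    by rewrite ffunE (eqP (negbNE (fi v))) (eqP (negbNE (fi u))).
  rewrite (eq_bigl xpredT) => [|i]; last exact: K.
  have -> : [set i | [exists v, f v != i]]%SET = [set: 'I_k]%SET.
    by apply/finset.setP => i; rewrite !inE K.
  rewrite cardsT card_ord sum_neq mulrBr mulVf// mulr1 big1 ?mulr0 ?addr0// => j _.
  case: (f =P [ffun=> j]) => // fj; case/eqP: fE.
  by apply/ffunP => v; rewrite fj !ffunE.
Qed.

Lemma sum_multinomial_train_mean (u : x) : (1 < k)%N -> p = k%:R^-1 ->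
  \sum_(f : {ffun x -> 'I_k}) (\prod_(u : x) k%:R^-1) *
    (#|[set i | [exists v, f v != i]]%SET|%:R^-1 *
      \sum_(i | [exists v, f v != i]) (f u != i)%:R) =
  (1 - p) * discard_factor Multinomial k #|` x| p.
Proof.
move=> k_gt1 pE; have q1 := uniform_weight k_gt1.
under eq_bigr => f _ do rewrite mean_multinomial_train// mulrDr mulrCA.
rewrite big_split/= -mulr_suml (sum_prod_weight x q1) mul1r -mulr_sumr.
(* The probability that all marks agree: [k] constant maps, each of weight [k%:R ^- n] for [n]
   points. *)
have -> : \sum_(f : {ffun x -> 'I_k}) (\prod_(u : x) k%:R^-1) *
    \sum_j (f == [ffun=> j])%:R = k%:R * k%:R ^- #|` x| :> R.
  under eq_bigr => f _ do rewrite mulr_sumr.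
  rewrite exchange_big/= (eq_bigr (fun=> k%:R ^- #|` x|)) => [|j _].
    by rewrite sumr_const card_ord mulr_natl.
  rewrite (bigD1 [ffun=> j])//= eqxx mulr1.
  rewrite [X in _ + X]big1 ?addr0 => [|f /negbTE ->].
    by rewrite prodr_const -cardfE exprVn.
  by rewrite mulr0.
(* Since the pattern contains [u], the exponent [n.-1] in the discard factor is a genuine
   predecessor. *)
have : (0 < #|` x|)%N by rewrite cardfE; apply/card_gt0P; exists u.
case: #|` x| => // n _; rewrite /discard_factor pE/= exprS.
have k_neq0 : k%:R != 0 :> R by rewrite pnatr_eq0; lia.
have k1_neq0 : k%:R - 1 != 0 :> R by rewrite subr_eq0 (eqr_nat R k 1); lia.
by field; rewrite k1_neq0 expf_neq0.
Qed.

End cross_validation_law.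

(** A common interface for both schemes, from which all the expectations are derived. The mean
    clauses are indexed by points, hence vacuous for the empty pattern, where the thinning factor is
    [0 / 0]. *)
Lemma cv_finite_model (R : realType) (S : choiceType) (d : measure_display)
    (T : measurableType d) (P : probability T R) (sch : cv_scheme) (k : nat)
    (p : R) (x : {fset S}) (V : 'I_k -> T -> {fset S}) :
  cv_partitioning P sch p x V ->
  exists (A : finType) (Z : T -> A) (law : A -> R) (train : A -> 'I_k -> x -> bool),
  [/\ has_finite_law P Z law,
      forall w i u, train (Z w) i u = (val u \notin V i w),
      forall i u, \sum_a law a * (train a i u)%:R = 1 - p
    & forall u, \sum_a law a *
        (#|[set i | [exists v, train a i v]]%SET|%:R^-1 *
          \sum_(i | [exists v, train a i v]) (train a i u)%:R) =
        (1 - p) * discard_factor sch k #|` x| p].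
Proof.
case: sch => [[_ p01 cvV]|[k_gt1 pE cvV]].
  exists {ffun 'I_k -> {ffun x -> bool}}.
  exists (fun w => [ffun i => [ffun u : x => val u \in V i w]]).
  eexists.
  exists (fun (f : {ffun 'I_k -> {ffun x -> bool}}) i u => ~~ f i u); split.
  - exact: monte_carlo_law cvV.
  - by move=> w i u; rewrite !ffunE.
  - exact: sum_monte_carlo_train.
  - by move=> u; exact: sum_monte_carlo_train_mean.
have [Z [lawZ VE]] := multinomial_law cvV.
exists {ffun x -> 'I_k}, Z; eexists.
exists (fun (f : {ffun x -> 'I_k}) i u => f u != i); split.
- exact: lawZ.
- by move=> w i u; rewrite VE.
- by move=> i u; exact: sum_multinomial_train.
- by move=> u; exact: sum_multinomial_train_mean.
Qed.

(** * Minimisers of the three loss functions *)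

Section loss_minimisers.
Context (R : realType) (k : nat) (K : {set 'I_k}) (theta : 'I_k -> R) (c : R).
Context (Itilde : 'I_k -> R -> R).
Hypotheses (k_gt0 : (0 < k)%N) (c_neq0 : c != 0).
Hypothesis ItildeE : forall i t, Itilde i t = (i \in K)%:R * (c * (theta i - t)).

Let m := sample_mean K theta.

Lemma square_minimiser i : i \in K ->
  uniquely_minimised_at (fun t => Itilde i t ^+ 2) (theta i).
Proof.
move=> iK; apply: (@quadratic_uniquely_minimised_at _ _ (c ^+ 2) 0) => [|s].
  by rewrite exprn_even_gt0.
by rewrite ItildeE iK mul1r; ring.
Qed.

Lemma loss1E t : loss1 Itilde t =
  k%:R^-1 * `|c| * \sum_(y <- [seq theta i | i in K]) `|y - t|.
Proof.
rewrite /loss1 -mulrA big_map big_enum; congr (_ * _).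
rewrite mulr_sumr [RHS]big_mkcond/=.
apply: eq_bigr => i _; rewrite ItildeE; case: ifP => iK.
  by rewrite mul1r normrM.
by rewrite mul0r normr0.
Qed.

Let scale1_gt0 : 0 < k%:R^-1 * `|c|.
Proof. by rewrite mulr_gt0 ?invr_gt0 ?ltr0n ?normr_gt0. Qed.

Lemma loss1_minimiser :
  minimised_at (loss1 Itilde) (sample_median [seq theta i | i in K]).
Proof.
apply: global_minimised_at => s; rewrite !loss1E ler_pM2l//.
exact: sample_median_min.
Qed.

Lemma loss1_minimiser_odd : odd #|K| ->
  uniquely_minimised_at (loss1 Itilde) (sample_median [seq theta i | i in K]).
Proof.
move=> Kodd; apply: convex_uniquely_minimised_at => [l a b l01|s sm].
  rewrite !loss1E !(mulrCA _ (k%:R^-1 * `|c|)) -mulrDr ler_pM2l//.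
  exact: sum_deviations_convex.
rewrite !loss1E ltr_pM2l//; apply: sample_median_odd_min => //.
by rewrite size_image.
Qed.

(** In this product form the identity also holds for empty [K], both sides being 0. *)
Lemma sum_theta : \sum_(i in K) theta i = #|K|%:R * m.
Proof.
rewrite /m /sample_mean; have [->|K0] := eqVneq K finset.set0.
  by rewrite big_set0 cards0 mul0r.
by rewrite mulVKf// pnatr_eq0 cards_eq0.
Qed.

(** Decomposition of a sum of squares around the mean: the deviations from [m] sum to 0, so the
    cross term vanishes. *)
Lemma loss2E t : loss2 Itilde t = k%:R^-1 * c ^+ 2 * #|K|%:R * (t - m) ^+ 2 +
  k%:R^-1 * c ^+ 2 * \sum_(i in K) (theta i - m) ^+ 2.
Proof.
have -> : loss2 Itilde t = k%:R^-1 * (c ^+ 2 * \sum_(i in K) (theta i - t) ^+ 2).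
  rewrite /loss2; congr (_ * _).
  rewrite mulr_sumr [RHS]big_mkcond/=; apply: eq_bigr => i _; rewrite ItildeE.
  by case: ifP => iK; [rewrite mul1r exprMn|rewrite mul0r expr0n].
have -> : \sum_(i in K) (theta i - t) ^+ 2 =
    \sum_(i in K) ((t - m) ^+ 2 + (theta i - m) ^+ 2
      - (theta i - m) * (2 * (t - m))).
  by apply: eq_bigr => i _; ring.
rewrite big_split big_split/= sumr_const sumrN -mulr_suml sumrB sumr_const.
rewrite sum_theta.
by rewrite -(mulr_natl (_ ^+ 2)) -(mulr_natl m); ring.
Qed.

Lemma loss3E t : loss3 Itilde t = (k%:R^-1 * c * #|K|%:R) ^+ 2 * (t - m) ^+ 2 + 0.
Proof.
rewrite /loss3 (_ : \sum_i Itilde i t = c * \sum_(i in K) (theta i - t)).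
  by rewrite sumrB sumr_const sum_theta -(mulr_natl t); ring.
rewrite mulr_sumr [RHS]big_mkcond/=; apply: eq_bigr => i _; rewrite ItildeE.
by case: ifP => iK; rewrite ?mul1r ?mul0r.
Qed.

Lemma loss2_minimiser : minimised_at (loss2 Itilde) m.
Proof.
apply: quadratic_minimised_at loss2E.
by rewrite mulr_ge0// mulr_ge0 ?sqr_ge0// invr_ge0.
Qed.

Lemma loss3_minimiser : minimised_at (loss3 Itilde) m.
Proof. by apply: quadratic_minimised_at loss3E; exact: sqr_ge0. Qed.

Lemma loss2_minimiser_unique : (0 < #|K|)%N ->
  uniquely_minimised_at (loss2 Itilde) m.
Proof.
move=> K_gt0; apply: quadratic_uniquely_minimised_at loss2E.
rewrite mulr_gt0 ?ltr0n// mulr_gt0 ?invr_gt0 ?ltr0n//.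
by rewrite exprn_even_gt0.
Qed.

Lemma loss3_minimiser_unique : (0 < #|K|)%N ->
  uniquely_minimised_at (loss3 Itilde) m.
Proof.
move=> K_gt0; apply: quadratic_uniquely_minimised_at loss3E.
by rewrite exprn_even_gt0//= !mulf_neq0// ?invr_neq0// pnatr_eq0 -lt0n.
Qed.

End loss_minimisers.

(** * Training sums and nondegeneracy of the constants *)

Lemma weighted_sum_train (R : realType) (S : completeMetricType R) (W : set S)
    (h : S -> R) (x V : {fset S}) :
  weighted_sum W h (x `\` V)%fset =
  \sum_(u : x) (val u \notin V)%:R * ((val u \in W)%:R * h (val u)).
Proof.
rewrite /weighted_sum (perm_big [seq u <- x | u \notin V]) => [|]; last first.
  apply: uniq_perm; rewrite ?filter_uniq ?fset_uniq// => u.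
  by rewrite mem_filter in_fsetD.
rewrite big_filter_cond big_seq_fsetE [LHS]big_mkcond; apply: eq_bigr => u _ /=.
by case: (_ \notin _); case: (_ \in W); rewrite /= ?mul1r ?mul0r.
Qed.

Lemma cv_partitioning_bounds (R : realType) (S : choiceType)
    (d : measure_display) (T : measurableType d) (P : probability T R)
    (sch : cv_scheme) (k : nat) (p : R) (x : {fset S})
    (V : 'I_k -> T -> {fset S}) :
  cv_partitioning P sch p x V -> (0 < k)%N /\ 0 < p < 1.
Proof.
case: sch => [[]|[k_gt1 -> _]] //; split; first exact: ltnW.
by rewrite invr_gt0 ltr0n ltnW//= invf_lt1 ?ltr1n// ltr0n ltnW.
Qed.

(** The upper bound excludes infinite integrals, whose real-valued version would be 0. *)
Lemma h_integral_neq0 (R : realType) (S : completeMetricType R)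
    (mu : {measure set (borel S) -> \bar R}) (W : set S) (h : S -> R) :
  (0 < `| \int[mu]_(u in (W : set (borel S))) (h u)%:E | < +oo)%E ->
  h_integral mu W h != 0.
Proof.
rewrite /h_integral /Rintegral; case: (integral _ _ _) => [r| |] /=.
- by rewrite lte_fin normr_gt0 => /andP[].
- by rewrite ltxx andbF.
- by rewrite ltxx andbF.
Qed.

Theorem theorem3
  (R : realType) (S : completeMetricType R) (sepS : separable S)
  (mu : {measure set (borel S) -> \bar R})
  (d0 : measure_display) (T0 : measurableType d0) (P0 : probability T0 R)
  (X : T0 -> set S) (theta0 : R) (theta0_gt0 : 0 < theta0)
  (ppX : point_process X) (homX : homogeneous mu P0 X theta0)
  (W : set S) (mW : measurable (W : set (borel S)))
  (w0 : T0) (x : {fset S}) (xE : [set` x] = X w0 `&` W)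
  (h : S -> R) (mh : measurable_fun (W : set (borel S)) h)
  (h_int : (0 < `| \int[mu]_(u in (W : set (borel S))) (h u)%:E | < +oo)%E)
  (sch : cv_scheme) (k : nat) (p : R)
  (d : measure_display) (T : measurableType d) (P : probability T R)
  (V : 'I_k -> T -> {fset S}) (cvV : cv_partitioning P sch p x V)
  (I : 'I_k -> T -> bool) :
  let xT i w := (x `\` V i w)%fset in
  let I_nonempty := forall i w, I i w = (1 <= #|` xT i w|)%N in
  let I_one := forall i w, I i w = true in
  let Itilde w i theta := (I i w)%:R * innovation mu W h p (xT i w) theta in
  let Tk w := [set i | I i w]%SET in
  let theta_h w i := theta_hat mu W h p (xT i w) in
  let theta_1 w := sample_median [seq theta_h w i | i in Tk w] in
  let theta_23 w := sample_mean (Tk w) (theta_h w) in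
  I_nonempty \/ I_one ->
  (forall w,
    [/\ forall i, theta_h w i = theta_tilde mu W h (xT i w) / (1 - p),
        forall i, xT i w = fset0 -> theta_h w i = 0,
        forall i, i \in Tk w ->
          uniquely_minimised_at (fun theta => Itilde w i theta ^+ 2) (theta_h w i),
        (theta_1 w = sample_median
           [seq (1 - p)^-1 * theta_tilde mu W h (xT i w) | i in Tk w]) /\
        (minimised_at (loss1 (Itilde w)) (theta_1 w)) /\
        (odd #|Tk w| -> uniquely_minimised_at (loss1 (Itilde w)) (theta_1 w)) &
        (theta_23 w = ((1 - p) * #|Tk w|%:R)^-1 *
           \sum_(i in Tk w) theta_tilde mu W h (xT i w)) /\
        (minimised_at (loss2 (Itilde w)) (theta_23 w)) /\
        (minimised_at (loss3 (Itilde w)) (theta_23 w)) /\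
        ((0 < #|Tk w|)%N ->
           uniquely_minimised_at (loss2 (Itilde w)) (theta_23 w) /\
           uniquely_minimised_at (loss3 (Itilde w)) (theta_23 w))]) /\
  [/\ theta_tilde mu W h x =
        (\sum_(u <- x | u \in W) h u) / (\int[mu]_(u in (W : set (borel S))) h u),
      forall J : {set 'I_k}, (0 < #|J|)%N ->
        ('E_P[fun w => sample_mean J (theta_h w)] = (theta_tilde mu W h x)%:E)%E,
      I_one -> ('E_P[theta_23] = (theta_tilde mu W h x)%:E)%E &
      I_nonempty ->
        ('E_P[theta_23] =
          (discard_factor sch k #|` x| p * theta_tilde mu W h x)%:E)%E].
Proof.
move=> xT I_nonempty I_one Itilde Tk theta_h theta_1 theta_23 I_cases.
have [k_gt0 p01] := cv_partitioning_bounds cvV.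
have p1_neq0 : 1 - p != 0 by rewrite subr_eq0 gt_eqF//; case/andP: p01.
have H_neq0 : h_integral mu W h != 0 by exact: h_integral_neq0.
pose c := (1 - p) * h_integral mu W h.
have c_neq0 : c != 0 by rewrite mulf_neq0.
have thetaE w i : theta_h w i = theta_tilde mu W h (xT i w) / (1 - p).
  by rewrite /theta_h /theta_hat /theta_tilde; field; rewrite p1_neq0.
have ItildeE w i t : Itilde w i t = (i \in Tk w)%:R * (c * (theta_h w i - t)).
  rewrite /Itilde /Tk inE; congr (_ * _).
  by rewrite /innovation /theta_h /theta_hat /c; field; rewrite H_neq0.
split=> [w|].
  split.
  - exact: thetaE.
  - move=> i xT0; rewrite /theta_h /theta_hat xT0 /weighted_sum.
    by rewrite big_seq_cond big1 ?mul0r// => u; rewrite in_fset0.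
  - by move=> i iT; apply: (square_minimiser c_neq0 (ItildeE w)).
  - split.
      by congr sample_median; apply: eq_map => i; rewrite thetaE mulrC.
    split; first exact: loss1_minimiser (ItildeE w).
    by move=> Todd; apply: loss1_minimiser_odd (ItildeE w) Todd.
  - split.
      rewrite /theta_23 /sample_mean (eq_bigr _ (fun i _ => thetaE w i)).
      by rewrite -mulr_suml invfM; ring.
    split; first exact: loss2_minimiser (ItildeE w).
    split; first exact: loss3_minimiser (ItildeE w).
    by move=> T_gt0; split;
      [apply: loss2_minimiser_unique (ItildeE w) T_gt0
      |apply: loss3_minimiser_unique (ItildeE w) T_gt0].
have [A [Z [law [train [lawZ trainE mean_train mean_retained]]]]] :=
  cv_finite_model cvV.
(* The contribution of [u] to an estimate whose training set contains it. *)
pose g (u : x) := (val u \in W)%:R * h (val u) / c.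
have theta_hE w i : theta_h w i = \sum_u g u * (train (Z w) i u)%:R.
  rewrite /theta_h /theta_hat weighted_sum_train mulr_suml -/c.
  by apply: eq_bigr => u _; rewrite trainE /g; ring.
have theta_xE : theta_tilde mu W h x = \sum_u g u * (1 - p).
  rewrite /theta_tilde /weighted_sum big_seq_fsetE big_mkcond/= mulr_suml.
  apply: eq_bigr => u _; rewrite /g /c; case: (_ \in W) => /=.
    by field; rewrite ?p1_neq0 ?H_neq0.
  by rewrite !mul0r.
(* By linearity it suffices to treat one point at a time: its training membership, averaged over a
   possibly random set of folds, must have mean [(1 - p) * y]. *)
have meanE (K : A -> {set 'I_k}) (y : R) :
    (forall u, \sum_a law a * (#|K a|%:R^-1 *
       \sum_(i in K a) (train a i u)%:R) = (1 - p) * y) ->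
    ('E_P[fun w => sample_mean (K (Z w)) (theta_h w)] =
      (y * theta_tilde mu W h x)%:E)%E.
  move=> Ky.
  pose G a := \sum_u g u * (#|K a|%:R^-1 * \sum_(i in K a) (train a i u)%:R).
  rewrite (_ : (fun w => _) = (fun w => G (Z w))); last first.
    apply/funext => w; rewrite /sample_mean /G.
    under eq_bigr do rewrite theta_hE.
    rewrite exchange_big/= mulr_sumr; apply: eq_bigr => u _.
    by rewrite -mulr_sumr mulrCA.
  rewrite (expectation_finite_law _ lawZ); congr EFin.
  rewrite theta_xE mulr_sumr; under eq_bigr do rewrite mulr_sumr.
  rewrite exchange_big/=; apply: eq_bigr => u _.
  under eq_bigr do rewrite mulrCA.
  by rewrite -mulr_sumr Ky; ring.
have mean_fixed (J : {set 'I_k}) : (0 < #|J|)%N ->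
    ('E_P[fun w => sample_mean J (theta_h w)] = (theta_tilde mu W h x)%:E)%E.
  (* For a deterministic set of folds the average commutes with the expectation, and every fold
     contributes [1 - p]. *)
  move=> J_gt0; rewrite (meanE (fun=> J) 1) ?mul1r// => u.
  under eq_bigr do rewrite mulrCA mulr_sumr.
  rewrite -mulr_sumr exchange_big/=.
  rewrite (eq_bigr (fun=> 1 - p)) => [|i _]; last exact: mean_train.
  rewrite sumr_const -[X in _ * X]mulr_natl mulrA mulVf ?mul1r ?mulr1//.
  by rewrite pnatr_eq0 -lt0n.
split=> //.
- move=> I1; rewrite -(mean_fixed [set: 'I_k]%SET); last by rewrite cardsT card_ord.
  congr expectation; apply/funext => w; congr sample_mean.
  by apply/finset.setP => i; rewrite !inE I1.
(* The retained set is a function of the finite random element: a training set is nonempty exactly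
   when some point of the pattern avoids the validation set. *)
- move=> IE; pose K a := [set i | [exists v, train a i v]]%SET.
  rewrite -(meanE K) => [|u].
    congr expectation; apply/funext => w; congr sample_mean.
    apply/finset.setP => i; rewrite !inE IE cardfs_gt0.
    apply/fset0Pn/existsP => [[u]|[v]].
      rewrite in_fsetD => /andP[uV ux]; exists [` ux]%fset.
      by rewrite trainE.
    rewrite trainE => vV; exists (val v).
    by rewrite in_fsetD vV (valP v).
  rewrite -(mean_retained u); apply: eq_bigr => a _; congr (_ * (_ * _)).
  by apply: eq_bigl => i; rewrite inE.
Qed.
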